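(* Let $L$ be a finite lattice and let $\mathbf{m}$ be a maximal chain of $L$. Then $\mathbf{m}$ is a chief chain of $L$ if and only if $\mathbf{m}$ is a chain-modular maximal chain.
   Context: A maximal chain $\mathbf{m}$ of a lattice $L$ is a chief chain (also called an $M$-chain) if for every chain $\mathbf{c}$ of $L$, the sublattice of $L$ generated by $\mathbf{m}\cup\mathbf{c}$ is distributive. An element $m\in L$ is left-modular if for all $x<y$ in $L$ one has $x\vee(m\wedge y)=(x\vee m)\wedge y$. A chain $\mathbf{m}$ in $L$ is right chain-modular if for every pair $x<y$ of elements of $\mathbf{m}$ and every $z\in L$ one has $x\vee(z\wedge y)=(x\vee z)\wedge y$. A chain is chain-modular if it is right chain-modular and each of its elements is left-modular. *)

(* Defs.v *)
From mathcomp Require Import all_boot all_order.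
Set Implicit Arguments.
Unset Strict Implicit.
Unset Printing Implicit Defensive.
Import Order.LTheory.
Local Open Scope order_scope.

Section ChainModular.
Context {d : Order.disp_t} {L : finLatticeType d}.
Implicit Types (A S c m : {set L}) (x y z : L).

Definition chain c : bool := [forall x in c, forall y in c, x >=< y].

Definition maximal_chain m : bool := maxset chain m.

Definition sublattice S : bool :=
  [forall x in S, forall y in S, (x `&` y \in S) && (x `|` y \in S)].

Lemma sublatticeP S :
  reflect (Order.ClosedPredicates.meet_closed S /\
           Order.ClosedPredicates.join_closed S)
          (sublattice S).
Proof.
apply: (iffP forall_inP) => [H | [HI HU] x xS].
  by split=> x y xS yS; have /forall_inP/(_ y yS)/andP[] := H x xS.
by apply/forall_inP => y yS; rewrite HI ?HU.
Qed.

Definition generated_sublattice A : {set L} :=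
  \bigcap_(S : {set L} | sublattice S && (A \subset S)) S.

(* For a sublattice S: one distributive law, which in a lattice implies the
   dual one. *)
Definition distributive_in S : Prop :=
  {in S & &, left_distributive (@Order.meet d L) (@Order.join d L)}.

Definition chief_chain m : Prop :=
  maximal_chain m /\
  forall c, chain c -> distributive_in (generated_sublattice (m :|: c)).

Definition left_modular x0 : Prop :=
  forall x y, x < y -> x `|` (x0 `&` y) = (x `|` x0) `&` y.

Definition right_chain_modular m : Prop :=
  chain m /\
  {in m &, forall x y, x < y ->
    forall z, x `|` (z `&` y) = (x `|` z) `&` y}.

Definition chain_modular m : Prop :=
  right_chain_modular m /\ {in m, forall x, left_modular x}.

End ChainModular.

(* Main.v *)
(** In a distributive lattice a join of [a_(i+1) /\ b_i], with [a] increasing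
    and [b] decreasing, is also the meet of the [a_i \/ b_i]. Chain modularity
    of [a] suffices for this identity: one induction step uses left modularity
    of [a_k] and right chain modularity of [a_k <= a_(k+1)] once each. When [a]
    enumerates the maximal chain and [b] runs through the decreasing sequences
    in a second chain, the join form shows that these elements depend on [b]
    through a join morphism, and the meet form that it is a meet morphism. The
    decreasing sequences form a distributive lattice, so its image is a
    distributive sublattice, and it contains both chains. *)
Require Import Defs.
From mathcomp Require Import all_boot all_order.
Import Order.LTheory.
Local Open Scope order_scope.

Section ChainModularLattice.
Context {d : Order.disp_t} {L : finLatticeType d}.
Implicit Types (c m : {set L}) (x y z t : L) (a b : nat -> L).

(** * Chains, comparability and extremal elements *)

Lemma chainP c : reflect {in c &, forall x y, x >=< y} (chain c).
Proof.
apply: (iffP forall_inP) => [H x y xc yc | H x xc].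
  by have /forall_inP/(_ y yc) := H x xc.
by apply/forall_inP => y yc; apply: H.
Qed.

(** In any lattice, the join of two comparable elements is the larger one, and meeting with [z]
    preserves the order. This law and its dual later turn pointwise operations on sequences into
    operations on [stair_join] and [stair_meet]. *)
Lemma comparable_meetUl {x y} z :
  x >=< y -> (x `|` y) `&` z = (x `&` z) `|` (y `&` z).
Proof.
by case/orP=> xy; [rewrite !join_r | rewrite !join_l] => //; rewrite leI2.
Qed.

Lemma comparable_joinIl {x y} z :
  x >=< y -> (x `&` y) `|` z = (x `|` z) `&` (y `|` z).
Proof.
by case/orP=> xy; [rewrite !meet_l | rewrite !meet_r] => //; rewrite leU2.
Qed.

Lemma chainU1 c x : (forall y, x >=< y) -> chain c -> chain (x |: c).
Proof.
move=> cx /chainP cc; apply/chainP => y z.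
by rewrite !in_setU1 => /predU1P[->|yc] /predU1P[->|zc] //;
  [rewrite comparable_sym | apply: cc].
Qed.

Lemma maximal_chain_mem m x :
  maximal_chain m -> (forall y, x >=< y) -> x \in m.
Proof.
case/maxsetP=> cm maxm cx.
by rewrite -(maxm _ (chainU1 _ _ cx cm) (subsetUr _ _)) setU11.
Qed.

Lemma finlattice_top (x0 : L) : exists t, forall x, x <= t.
Proof.
suff [t ht]: exists t, {in enum L, forall x, x <= t}.
  by exists t => x; apply: ht; rewrite mem_enum.
elim: (enum L) => [|y s [t IH]]; first by exists x0.
exists (y `|` t) => x; rewrite inE => /predU1P[->|/IH xt]; first exact: leUl.
exact: le_trans xt (leUr _ _).
Qed.

Lemma finlattice_bottom (x0 : L) : exists z, forall x, z <= x.
Proof.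
suff [z hz]: exists z, {in enum L, forall x, z <= x}.
  by exists z => x; apply: hz; rewrite mem_enum.
elim: (enum L) => [|y s [z IH]]; first by exists x0.
exists (y `&` z) => x; rewrite inE => /predU1P[->|/IH zx]; first exact: leIl.
exact: le_trans (leIr _ _) zx.
Qed.

(** * Staircase joins and meets of two sequences *)

Fixpoint stair_join a b k : L :=
  if k is i.+1 then stair_join a b i `|` (b i `&` a i.+1) else a 0.

Fixpoint stair_meet t a b k : L :=
  if k is i.+1 then stair_meet t a b i `&` (b i `|` a i) else t.

Lemma stair_join_le a b k x :
  a 0 <= x -> (forall i, b i `&` a i.+1 <= x) -> stair_join a b k <= x.
Proof. by move=> a0 ab; elim: k => //= k IH; rewrite leUx IH ab. Qed.

Lemma le_stair_join0 a b k : a 0 <= stair_join a b k.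
Proof. by elim: k => //= k IH; apply: le_trans IH (leUl _ _). Qed.

Lemma le_stair_join a b k i :
  (i < k)%N -> b i `&` a i.+1 <= stair_join a b k.
Proof.
elim: k => //= k IH; rewrite ltnS leq_eqVlt => /predU1P[->|/IH ik].
  exact: leUr.
exact: le_trans ik (leUl _ _).
Qed.

Lemma eq_stair_join a b b' k :
  b =1 b' -> stair_join a b k = stair_join a b' k.
Proof. by move=> bb'; elim: k => //= k ->; rewrite bb'. Qed.

Lemma stair_joinU a b b' k : (forall i, b i >=< b' i) ->
  stair_join a (fun i => b i `|` b' i) k =
  stair_join a b k `|` stair_join a b' k.
Proof.
move=> cb; elim: k => [|k IH] /=; first by rewrite joinxx.
by rewrite IH (comparable_meetUl _ (cb k)) joinACA.
Qed.

Lemma stair_meetI t a b b' k : (forall i, b i >=< b' i) ->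
  stair_meet t a (fun i => b i `&` b' i) k =
  stair_meet t a b k `&` stair_meet t a b' k.
Proof.
move=> cb; elim: k => [|k IH] /=; first by rewrite meetxx.
by rewrite IH (comparable_joinIl _ (cb k)) meetACA.
Qed.

(** Each factor has an index [i < k], so it lies above [b i] and hence above [b k]. *)
Lemma le_stair_meet t a b k :
  (forall x, x <= t) -> (forall i j, (i <= j)%N -> b j <= b i) ->
  b k <= stair_meet t a b k.
Proof.
move=> tP hb.
(* The bound [b k] stays fixed while the length [i] of the meet grows. *)
suff H i : (i <= k)%N -> b k <= stair_meet t a b i by exact: H.
elim: i => //= i IH ik; rewrite lexI IH; last exact: ltnW.
by rewrite (le_trans (hb _ _ (ltnW ik))) ?leUl.
Qed.

Lemma left_modular_le x0 x y : left_modular x0 -> x <= y ->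
  x `|` (x0 `&` y) = (x `|` x0) `&` y.
Proof.
by move=> mx0; rewrite le_eqVlt => /predU1P[->|/mx0//]; rewrite joinIKC meetKUC.
Qed.

Lemma right_chain_modular_le m x y z : right_chain_modular m ->
  x \in m -> y \in m -> x <= y -> x `|` (z `&` y) = (x `|` z) `&` y.
Proof.
case=> _ rm xm ym; rewrite le_eqVlt => /predU1P[->|/rm->//].
by rewrite joinIKC meetKUC.
Qed.

(** The final meet with [a k] truncates the formula so that it can be proved by induction; it
    disappears once [a k] is the top [t]. *)
Lemma stair_join_meet t m a b k :
  chain_modular m -> (forall i, a i \in m) ->
  (forall i, a i <= a i.+1) -> (forall x, x <= t) ->
  (forall i j, (i <= j)%N -> b j <= b i) ->
  stair_join a b k = stair_meet t a b k `&` a k.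
Proof.
move=> [rm lm] am ha tP hb; elim: k => [|k IH] /=; first by rewrite meet_r.
have bk := le_stair_meet t a b k tP hb.
(* The new term lies below [b k], hence below [stair_meet t a b k], so left modularity of [a k]
   pulls this meet out of the join. Right chain modularity then turns what remains into the new
   factor, cut off at [a k.+1]. *)
rewrite IH joinC [_ `&` a k]meetC left_modular_le //; last first.
- exact: le_trans (leIl _ _) bk.
- exact: lm.
rewrite [_ `|` a k]joinC (right_chain_modular_le m) //.
by rewrite [a k `|` _]joinC meetC meetA.
Qed.

(** * Enumerated chains and decreasing functions on them *)

Lemma chain_enumeration m t : chain m -> t \in m -> (forall x, x <= t) ->
  exists (a : nat -> L) (n : nat),
    [/\ forall i, a i \in m, forall i j, (i <= j)%N -> a i <= a j,
        a n.+1 = t & {in m, forall x, exists2 i, (i <= n)%N & a i = x}].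
Proof.
move=> /chainP cm tm tP; set s := sort <=%O (enum m).
have mem_s x : (x \in s) = (x \in m) by rewrite mem_sort mem_enum.
have s_sorted : sorted <=%O s.
  by apply: (sort_sorted_in (P := mem m)) => //; apply/allP => x; rewrite mem_enum.
have s_gt0 : (0 < size s)%N by move: tm; rewrite -mem_s; case: s {mem_s s_sorted}.
(* The default [t] keeps the sequence increasing past the end of the list. The top is thus repeated
   at index [n.+1], which also covers a one-element chain. *)
exists (nth t s), (size s).-1; split=> [i|i j ij||x].
- have [lis|sli] := ltnP i (size s); first by rewrite -mem_s mem_nth.
  by rewrite nth_default.
- have [ljs|slj] := ltnP j (size s); last by rewrite [nth t s j]nth_default.
  by apply: (sorted_leq_nth le_trans le_refl) => //; rewrite inE (leq_ltn_trans ij).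
- by rewrite prednK // nth_default.
- rewrite -mem_s => xs; exists (index x s); last exact: nth_index.
  by rewrite -ltnS prednK // index_mem.
Qed.

(** Decreasing sequences are encoded as functions on the elements of [m] instead of indices. Finite
    functions on all of [L], constrained only on [m], form a finite type, so an image of this
    predicate is a finite set. *)
Definition antitone_into m c : pred {ffun L -> L} :=
  [pred f : {ffun L -> L} | [forall x in m, f x \in c] &&
     [forall x in m, forall y in m, (x <= y) ==> (f y <= f x)]].

Lemma antitone_intoP m c (f : {ffun L -> L}) :
  reflect ({in m, forall x, f x \in c} /\
           {in m &, forall x y, x <= y -> f y <= f x})
          (f \in antitone_into m c).
Proof.
apply: (iffP andP) => [[/forall_inP fc /forall_inP fm] | [fc fm]].
  by split=> // x y xm ym; have /forall_inP/(_ y ym)/implyP := fm x xm.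
split; apply/forall_inP => // x xm.
by apply/forall_inP => y ym; apply/implyP; apply: fm.
Qed.

Lemma antitone_into_op m c (op : L -> L -> L) (f g : {ffun L -> L}) :
  {in c &, forall x y, op x y \in c} ->
  (forall x x' y y', x <= x' -> y <= y' -> op x y <= op x' y') ->
  f \in antitone_into m c -> g \in antitone_into m c ->
  [ffun x => op (f x) (g x)] \in antitone_into m c.
Proof.
move=> opc opm /antitone_intoP[fc fm] /antitone_intoP[gc gm].
apply/antitone_intoP; split=> [x xm | x y xm ym xy]; rewrite !ffunE.
  by rewrite opc ?fc ?gc.
by rewrite opm ?fm ?gm.
Qed.

Lemma chain_sublattice c : chain c ->
  {in c &, forall x y, x `&` y \in c} /\ {in c &, forall x y, x `|` y \in c}.
Proof.
move=> /chainP cc; split=> x y xc yc; case/orP: (cc x y xc yc) => xy.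
- by rewrite meet_l.
- by rewrite meet_r.
- by rewrite join_r.
- by rewrite join_l.
Qed.

Lemma chain_modular_distributive m c :
  maximal_chain m -> chain_modular m -> chain c ->
  distributive_in (generated_sublattice (m :|: c)).
Proof.
move=> mm cmm cc0 x0 y0 z0 x0S y0S z0S.
have [t tP] := finlattice_top x0.
have [w wP] := finlattice_bottom x0.
have ct x : t >=< x by rewrite /Order.comparable tP orbT.
have cw x : w >=< x by rewrite /Order.comparable wP.
have tm := maximal_chain_mem m t mm ct; have wm := maximal_chain_mem m w mm cw.
have cm : chain m by case/maxsetP: mm.
have [a [n [am a_mono an a_onto]]] := chain_enumeration m t cm tm tP.
(* Adding top and bottom to [c] makes the two-valued step functions available, which are used to
   reach the elements of [m]. *)
pose c' := t |: (w |: c).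
have cc' : chain c' by do 2![apply: chainU1 => //].
have tc' : t \in c' by rewrite setU11.
have wc' : w \in c' by rewrite !inE eqxx orbT.
pose F := antitone_into m c'.
(* The shift matches [stair_join], whose term [i] pairs [b i] with [a i.+1]. *)
pose b (f : {ffun L -> L}) i := f (a i.+1).
pose phi f := stair_join a (b f) n.+1.
have phi_meet f : f \in F -> phi f = stair_meet t a (b f) n.+1.
  case/antitone_intoP=> _ fm; rewrite /phi (stair_join_meet t m) //.
  - by rewrite an meet_l.
  - by move=> i; apply: a_mono.
  - by move=> i j ij; apply: fm => //; apply: a_mono.
have cF f g i : f \in F -> g \in F -> b f i >=< b g i.
  move=> /antitone_intoP[fc _] /antitone_intoP[gc _].
  by apply: (chainP _ cc'); [apply: fc | apply: gc].
have [c'I c'U] := chain_sublattice c' cc'.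
pose fU (f g : {ffun L -> L}) := [ffun x => f x `|` g x].
pose fI (f g : {ffun L -> L}) := [ffun x => f x `&` g x].
have FU f g : f \in F -> g \in F -> fU f g \in F.
  by apply: antitone_into_op => // *; apply: leU2.
have FI f g : f \in F -> g \in F -> fI f g \in F.
  by apply: antitone_into_op => // *; apply: leI2.
have phiU f g : f \in F -> g \in F -> phi (fU f g) = phi f `|` phi g.
  move=> fF gF; rewrite -stair_joinU => [|i]; last exact: cF.
  by apply: eq_stair_join => i; rewrite /b ffunE.
have phiI f g : f \in F -> g \in F -> phi (fI f g) = phi f `&` phi g.
  move=> fF gF; rewrite !phi_meet ?FI // -stair_meetI => [|i]; last exact: cF.
  by elim: n.+1 => //= k ->; rewrite /b ffunE.
have phiD f g h : f \in F -> g \in F -> h \in F ->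
    (phi f `|` phi g) `&` phi h = (phi f `&` phi h) `|` (phi g `&` phi h).
  (* Both sides become images under [phi] of pointwise combinations, which agree because the values
     lie in the chain [c']. *)
  move=> fF gF hF; rewrite -phiU // -!phiI ?FU // -phiU ?FI //.
  apply: eq_stair_join => i; rewrite /b !ffunE comparable_meetUl //.
  exact: cF.
pose S := [set phi f | f in F].
have sublS : sublattice S.
  apply/sublatticeP; split=> _ _ /imsetP[f fF ->] /imsetP[g gF ->].
    by rewrite -phiI // imset_f ?FI.
  by rewrite -phiU // imset_f ?FU.
have a0 x : a 0 <= x.
  by have [i _ aw] := a_onto _ wm; rewrite (le_trans (a_mono 0%N i _)) ?aw.
have mS : m \subset S.
  (* For this step function, a term of the join is [a i.+1] when that element is below [x], and
     bottom otherwise. *)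
  apply/subsetP => x xm; pose f := [ffun y => if y <= x then t else w].
  have fF : f \in F.
    apply/antitone_intoP; split=> [y _ | y z _ _ yz]; rewrite !ffunE.
      by case: ifP.
    by case: (boolP (z <= x)) => // zx; rewrite (le_trans yz zx).
  apply/imsetP; exists f => //; apply/le_anti/andP; split; last first.
    apply: stair_join_le => // i; rewrite /b ffunE; case: ifP => [ax|_].
      exact: le_trans (leIr _ _) ax.
    exact: le_trans (leIl _ _) (wP x).
  (* The terms start at [a 1], so [x = a 0] comes from the initial value of the join; otherwise
     [x = a i.+1] is itself term [i]. *)
  have [[|i] iN ax] := a_onto _ xm; first by rewrite -ax le_stair_join0.
  apply: le_trans (le_stair_join _ _ _ _ (leqW iN)).
  by rewrite /b ffunE ax lexx meet_r.
have cS : c \subset S.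
  (* For a constant function every term is below [x], and the last one is the meet of [x] with the
     top. *)
  apply/subsetP => x xc; pose f := [ffun y : L => x].
  have fF : f \in F.
    by apply/antitone_intoP; split=> [y _|y z _ _ _]; rewrite !ffunE ?inE ?xc ?orbT.
  apply/imsetP; exists f => //; apply/le_anti/andP; split; last first.
    by apply: stair_join_le => // i; rewrite /b ffunE leIl.
  by apply: le_trans (le_stair_join _ _ _ _ (ltnSn n)); rewrite /b ffunE an meet_l.
have genS : generated_sublattice (m :|: c) \subset S.
  by apply: bigcap_inf; rewrite sublS subUset mS.
move/(subsetP genS)/imsetP: x0S => [f fF ->].
move/(subsetP genS)/imsetP: y0S => [g gF ->].
move/(subsetP genS)/imsetP: z0S => [h hF ->].
exact: phiD.
Qed.

(** * From chief chains to chain modularity *)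

Lemma mem_generated_sublattice (A : {set L}) x :
  x \in A -> x \in generated_sublattice A.
Proof. by move=> xA; apply/bigcapP => S /andP[_ /subsetP]; apply. Qed.

Lemma distributive_in_modular (S : {set L}) x y z :
  distributive_in S -> x \in S -> y \in S -> z \in S -> x < y ->
  x `|` (z `&` y) = (x `|` z) `&` y.
Proof.
by move=> dS xS yS zS /ltW xy; rewrite dS // [x `&` y]meet_l.
Qed.

(** Each modular law involves three elements, so a small test chain suffices: the singleton of [z]
    for right chain modularity, and the pair [x < y] for left modularity. *)
Lemma chief_chain_modular m : chief_chain m -> chain_modular m.
Proof.
case=> mm dm; have cm : chain m by case/maxsetP: mm.
split; first split=> // x y xm ym xy z.
  have cz : chain [set z].
    by apply/chainP => u v /set1P-> /set1P->; apply: comparablexx.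
  by apply: (distributive_in_modular _ _ _ _ (dm _ cz)) => //;
    apply: mem_generated_sublattice; rewrite !inE ?xm ?ym ?eqxx ?orbT.
move=> z zm x y xy.
have cxy : chain [set x; y].
  by apply/chainP => u v /set2P[]-> /set2P[]->;
    rewrite ?comparablexx // /Order.comparable (ltW xy) ?orbT.
by apply: (distributive_in_modular _ _ _ _ (dm _ cxy)) => //;
  apply: mem_generated_sublattice; rewrite !inE ?zm ?eqxx ?orbT.
Qed.

End ChainModularLattice.

Theorem theorem1p2 (d : Order.disp_t) (L : finLatticeType d) (m : {set L})
    (hm : maximal_chain m) :
  chief_chain m <-> (maximal_chain m /\ chain_modular m).
Proof.
split=> [cm | [_ cmm]]; first by split=> //; apply: chief_chain_modular.
by split=> // c; apply: chain_modular_distributive.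
Qed.
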